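(* Let $L\dashv R$ be the free/underlying-set adjunction between $\mathsf{Set}$ and the category $\mathsf{Mod}(\mathsf{ABGRP})$ of abelian groups. Then there is a functor $$F_{\mathsf{ABGRP}}\colon\mathbb{Z}\text{-}\mathsf{Net}\to\mathsf{Mod}(\mathsf{ABGRP},\mathsf{Cat})$$ which is a left adjoint and which sends an integer net $P=(s,t\colon T\to RLS)$ to the $\mathsf{ABGRP}$-category $F_{\mathsf{ABGRP}}(P)$ such that - its abelian group of objects is the free abelian group $LS$, and - its morphisms are given by the free closure of $T$ (each $\tau\in T$ regarded as a morphism $\tau\colon s(\tau)\to t(\tau)$) under composition and identities, modulo the axioms of a category, and under monoidal product and inverses, modulo the axioms of an abelian group, where moreover the structure maps (source, target, identity, composition) are required to be abelian group homomorphisms. For a morphism of integer nets $(f,g)\colon P\to P'$, $F_{\mathsf{ABGRP}}(f,g)$ is the morphism of $\mathsf{ABGRP}$-categories which is given by $Lg$ on objects and, on morphisms, by the unique extension of $f$ which respects the abelian group operation and composition.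
   Context: $\mathsf{ABGRP}$ is the Lawvere theory of abelian groups; $\mathsf{Mod}(\mathsf{ABGRP})$ is its category of models in $\mathsf{Set}$, i.e. abelian groups and homomorphisms. $\mathsf{Mod}(\mathsf{ABGRP},\mathsf{Cat})$ is the category of product-preserving functors $\mathsf{ABGRP}\to\mathsf{Cat}$ and natural transformations; its objects, called $\mathsf{ABGRP}$-categories, are equivalently categories internal to abelian groups (the objects and the morphisms form abelian groups and source, target, identity and composition are homomorphisms), and its morphisms are internal functors. Let $\mathbb{Z}[X]=RLX$ be the underlying set of the free abelian group on a set $X$. An integer net ($\mathbb{Z}$-net) is a pair of functions $s,t\colon T\to\mathbb{Z}[S]$, with $T$ and $S$ sets. A morphism from $(s,t\colon T\to\mathbb{Z}[S])$ to $(s',t'\colon T'\to\mathbb{Z}[S'])$ is a pair of functions $(f\colon T\to T',\,g\colon S\to S')$ with $s'\circ f=\mathbb{Z}[g]\circ s$ and $t'\circ f=\mathbb{Z}[g]\circ t$. These form the category $\mathbb{Z}\text{-}\mathsf{Net}$. *)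

(* Defs.v *)
From HB Require Import structures.
From mathcomp Require Import all_boot all_algebra.
From mathcomp Require Import boolp.
From mathcomp Require Import freeg.

Set Implicit Arguments.
Unset Strict Implicit.
Unset Printing Implicit Defensive.

Import GRing.Theory.
Local Open Scope ring_scope.

Record category := Category {
  obj :> Type;
  hom : obj -> obj -> Type;
  idc : forall a, hom a a;
  compc : forall a b c, hom b c -> hom a b -> hom a c;
  compc1 : forall a b (f : hom a b), compc f (idc a) = f;
  comp1c : forall a b (f : hom a b), compc (idc b) f = f;
  compcA : forall a b c d (h : hom c d) (g : hom b c) (f : hom a b),
    compc h (compc g f) = compc (compc h g) f
}.
Arguments hom {_} _ _.
Arguments idc {_} a.
Arguments compc {_ a b c} g f.

Definition is_functor (C D : category) (F0 : C -> D)
    (F1 : forall a b : C, hom a b -> hom (F0 a) (F0 b)) : Prop :=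
  (forall a, F1 a a (idc a) = idc (F0 a)) /\
  (forall a b c (g : hom b c) (f : hom a b),
    F1 a c (compc g f) = compc (F1 b c g) (F1 a b f)).

Record functor (C D : category) := Functor {
  fobj :> C -> D;
  fmap : forall a b : C, hom a b -> hom (fobj a) (fobj b);
  functorP : is_functor fmap
}.
Arguments fmap {C D} F {a b} f : rename.

Record adjunction (C D : category) (F : functor C D) (G : functor D C) :=
  Adjunction {
  adj : forall (c : C) (d : D), hom (F c) d -> hom c (G d);
  adj_bij : forall c d, bijective (@adj c d);
  adj_nat : forall (c c' : C) (d d' : D)
      (f : hom c' c) (u : hom (F c) d) (h : hom d d'),
    adj (compc h (compc u (fmap F f))) =
    compc (fmap G h) (compc (adj u) f)
}.

Definition is_left_adjoint (C D : category) (F : functor C D) : Prop :=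
  exists G : functor D C, inhabited (adjunction F G).

Definition SET : category :=
  @Category Type (fun S T => S -> T) (fun _ x => x) (fun _ _ _ g f x => g (f x))
    (fun _ _ _ => erefl) (fun _ _ _ => erefl) (fun _ _ _ _ _ _ _ => erefl).

Lemma additive_ext (A B : zmodType) (f g : {additive A -> B}) :
  f =1 g -> f = g.
Proof.
case: f g => [f [[Pf]]] [g [[Pg]]] /= /funext fg.
by case: _ / fg Pg => Pg; rewrite (Prop_irrelevance Pf Pg).
Qed.

Definition additive_id (A : zmodType) : {additive A -> A} := idfun.
Definition additive_comp (A B C : zmodType)
    (g : {additive B -> C}) (f : {additive A -> B}) : {additive A -> C} :=
  g \o f.

Lemma additive_comp1 (A B : zmodType) (f : {additive A -> B}) :
  additive_comp f (additive_id A) = f.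
Proof. exact: additive_ext. Qed.

Lemma additive_1comp (A B : zmodType) (f : {additive A -> B}) :
  additive_comp (additive_id B) f = f.
Proof. exact: additive_ext. Qed.

Lemma additive_compA (A B C D : zmodType) (h : {additive C -> D})
    (g : {additive B -> C}) (f : {additive A -> B}) :
  additive_comp h (additive_comp g f) = additive_comp (additive_comp h g) f.
Proof. exact: additive_ext. Qed.

Definition AB : category :=
  @Category zmodType (fun A B => {additive A -> B}) additive_id additive_comp
    additive_comp1 additive_1comp additive_compA.

Section FreeAbelianGroup.
Variable S : Type.

(* [{freeg K}] wants a choiceType of generators; [{classic S}] is [S] with the
   choice structure given by the axiom of choice, so [S] is an arbitrary set. *)
Definition freeZ : zmodType := {freeg {classic S}}.

Definition freeZ_unit (x : S) : freeZ := << (x : {classic S}) >>.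

Variables (A : zmodType) (f : S -> A).

(* [zmodule A] is [A] with its canonical [int]-module structure. *)
Definition freeZ_lift_fun (D : freeZ) : A :=
  @fglift int (zmodule A) {classic S} f D.

Lemma freeZ_lift_is_additive : zmod_morphism freeZ_lift_fun.
Proof. exact: (@lift_is_additive int {classic S} (zmodule A) f). Qed.

HB.instance Definition _ :=
  GRing.isZmodMorphism.Build freeZ A freeZ_lift_fun freeZ_lift_is_additive.

Definition freeZ_lift : {additive freeZ -> A} := freeZ_lift_fun.

Lemma freeZ_liftU x : freeZ_lift (freeZ_unit x) = f x.
Proof. by rewrite /freeZ_lift /= /freeZ_lift_fun liftU scale1r. Qed.

End FreeAbelianGroup.

Lemma freeZ_ext (S : Type) (A : zmodType) (f g : {additive freeZ S -> A}) :
  (forall x, f (freeZ_unit x) = g (freeZ_unit x)) -> f = g.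
Proof.
move=> fg; apply: additive_ext => D.
rewrite -[D]freeg_sumE !raddf_sum; apply: eq_bigr => x _.
have -> : << coeff x D *g x >> = freeZ_unit (x : S) *~ coeff x D.
  by rewrite /freeZ_unit freegU_mulz intz.
by rewrite !raddfMz fg.
Qed.

Definition freeZ_map (S S' : Type) (g : S -> S') :
    {additive freeZ S -> freeZ S'} :=
  freeZ_lift (fun x => freeZ_unit (g x)).

Lemma freeZ_map_id (S : Type) : freeZ_map (fun x : S => x) = additive_id _.
Proof. by apply: freeZ_ext => x; rewrite freeZ_liftU. Qed.

Lemma freeZ_map_comp (S S' S'' : Type) (g' : S' -> S'') (g : S -> S') :
  freeZ_map (fun x => g' (g x)) = additive_comp (freeZ_map g') (freeZ_map g).
Proof. by apply: freeZ_ext => x; rewrite /= !freeZ_liftU. Qed.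

Definition L : functor SET AB :=
  @Functor SET AB freeZ freeZ_map (conj freeZ_map_id freeZ_map_comp).

Lemma forget_is_functor :
  @is_functor AB SET (fun A : zmodType => A : Type)
    (fun A B (f : {additive A -> B}) => f : A -> B).
Proof. by []. Qed.

Definition R : functor AB SET := Functor forget_is_functor.

Definition freeZ_transpose (S : Type) (A : zmodType)
    (f : {additive freeZ S -> A}) : S -> A :=
  fun x => f (freeZ_unit x).

Lemma freeZ_transpose_bij (S : Type) (A : zmodType) :
  bijective (@freeZ_transpose S A).
Proof.
exists (@freeZ_lift S A) => f.
  by apply: freeZ_ext => x; rewrite freeZ_liftU.
by apply/funext => x; rewrite /freeZ_transpose freeZ_liftU.
Qed.

Lemma freeZ_transpose_nat (S S' : Type) (A A' : zmodType)
    (f : S' -> S) (u : {additive freeZ S -> A}) (h : {additive A -> A'}) :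
  freeZ_transpose (additive_comp h (additive_comp u (freeZ_map f))) =
  (fun x => h (freeZ_transpose u (f x))).
Proof.
by apply/funext => x; rewrite /freeZ_transpose /= /freeZ_map freeZ_liftU.
Qed.

Definition free_forget_adjunction : adjunction L R :=
  @Adjunction SET AB L R freeZ_transpose freeZ_transpose_bij
    freeZ_transpose_nat.

Record znet := ZNet {
  trans : Type;
  place : Type;
  net_src : trans -> R (L place);
  net_tgt : trans -> R (L place)
}.
Arguments net_src {P} : rename.
Arguments net_tgt {P} : rename.

Record znet_hom (P P' : znet) := ZNetHom {
  on_trans : trans P -> trans P';
  on_place : place P -> place P';
  on_src : forall t, net_src (on_trans t) = fmap R (fmap L on_place) (net_src t);
  on_tgt : forall t, net_tgt (on_trans t) = fmap R (fmap L on_place) (net_tgt t)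
}.

Lemma znet_hom_ext (P P' : znet) (h k : znet_hom P P') :
  on_trans h = on_trans k -> on_place h = on_place k -> h = k.
Proof.
case: h k => [f g hs ht] [f' g' ks kt] /= ef eg.
case: _ / ef ks kt; case: _ / eg => ks kt.
by rewrite (Prop_irrelevance hs ks) (Prop_irrelevance ht kt).
Qed.

Lemma znet_id_proof (P : znet) (n : trans P -> R (L (place P))) t :
  n t = fmap R (fmap L (fun x => x)) (n t).
Proof. by change (n t = freeZ_map (fun x => x) (n t)); rewrite freeZ_map_id. Qed.

Definition znet_id (P : znet) : znet_hom P P :=
  @ZNetHom P P (fun t => t) (fun x => x)
    (znet_id_proof net_src) (znet_id_proof net_tgt).

Section ZNetComp.
Variables (P P' P'' : znet) (h' : znet_hom P' P'') (h : znet_hom P P').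

Lemma znet_comp_src t :
  net_src (on_trans h' (on_trans h t)) =
  fmap R (fmap L (fun x => on_place h' (on_place h x))) (net_src t).
Proof.
rewrite on_src on_src.
change (freeZ_map (on_place h') (freeZ_map (on_place h) (net_src t)) =
  freeZ_map (fun x => on_place h' (on_place h x)) (net_src t)).
by rewrite (freeZ_map_comp (on_place h') (on_place h)).
Qed.

Lemma znet_comp_tgt t :
  net_tgt (on_trans h' (on_trans h t)) =
  fmap R (fmap L (fun x => on_place h' (on_place h x))) (net_tgt t).
Proof.
rewrite on_tgt on_tgt.
change (freeZ_map (on_place h') (freeZ_map (on_place h) (net_tgt t)) =
  freeZ_map (fun x => on_place h' (on_place h x)) (net_tgt t)).
by rewrite (freeZ_map_comp (on_place h') (on_place h)).
Qed.

Definition znet_comp : znet_hom P P'' := ZNetHom znet_comp_src znet_comp_tgt.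
End ZNetComp.

Lemma znet_comp1 P P' (h : znet_hom P P') : znet_comp h (znet_id P) = h.
Proof. exact: znet_hom_ext. Qed.

Lemma znet_1comp P P' (h : znet_hom P P') : znet_comp (znet_id P') h = h.
Proof. exact: znet_hom_ext. Qed.

Lemma znet_compA P Q U V (h : znet_hom U V) (g : znet_hom Q U)
    (f : znet_hom P Q) :
  znet_comp h (znet_comp g f) = znet_comp (znet_comp h g) f.
Proof. exact: znet_hom_ext. Qed.

Definition ZNET : category :=
  Category znet_comp1 znet_1comp znet_compA.

(* Composition is diagrammatic: [icomp m n] is defined when the target of [m]
   is the source of [n].  [icompD] says that it is a homomorphism on the group
   of composable pairs. *)
Record abcat_on (ob : zmodType) := ABCatOn {
  mor : zmodType;
  src : {additive mor -> ob};
  tgt : {additive mor -> ob};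
  ident : {additive ob -> mor};
  icomp : forall m n : mor, tgt m = src n -> mor;
  src_ident : forall x, src (ident x) = x;
  tgt_ident : forall x, tgt (ident x) = x;
  src_icomp : forall m n (e : tgt m = src n), src (icomp e) = src m;
  tgt_icomp : forall m n (e : tgt m = src n), tgt (icomp e) = tgt n;
  icomp1l : forall x m (e : tgt (ident x) = src m), icomp e = m;
  icomp1r : forall m x (e : tgt m = src (ident x)), icomp e = m;
  icompA : forall m n p (mn : tgt m = src n) (np : tgt n = src p)
      (mn_p : tgt (icomp mn) = src p) (m_np : tgt m = src (icomp np)),
    icomp m_np = icomp mn_p;
  icompD : forall m n m' n' (e : tgt m = src n) (e' : tgt m' = src n')
      (ee' : tgt (m + m') = src (n + n')),
    icomp ee' = icomp e + icomp e'
}.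
Arguments icomp {ob a} m n e : rename.
Arguments src {ob a} : rename.
Arguments tgt {ob a} : rename.
Arguments ident {ob a} : rename.

Record abcat := ABCat {
  ob : zmodType;
  abcat_str :> abcat_on ob
}.

Record abcat_hom (C D : abcat) := ABCatHom {
  on_ob : {additive ob C -> ob D};
  on_mor : {additive mor C -> mor D};
  on_mor_src : forall m, src (on_mor m) = on_ob (src m);
  on_mor_tgt : forall m, tgt (on_mor m) = on_ob (tgt m);
  on_mor_ident : forall x, on_mor (ident x) = ident (on_ob x);
  on_mor_icomp : forall (m n : mor C) (e : tgt m = src n)
      (e' : tgt (on_mor m) = src (on_mor n)),
    on_mor (icomp m n e) = icomp (on_mor m) (on_mor n) e'
}.

Lemma abcat_hom_ext (C D : abcat) (h k : abcat_hom C D) :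
  on_ob h = on_ob k -> on_mor h = on_mor k -> h = k.
Proof.
case: h k => [f g h1 h2 h3 h4] [f' g' k1 k2 k3 k4] /= ef eg.
case: _ / ef k1 k2 k3; case: _ / eg k4 => k4 k1 k2 k3.
by rewrite (Prop_irrelevance h1 k1) (Prop_irrelevance h2 k2)
  (Prop_irrelevance h3 k3) (Prop_irrelevance h4 k4).
Qed.

Definition abcat_id (C : abcat) : abcat_hom C C.
Proof.
exists (additive_id (ob C)) (additive_id (mor C)) => // m n e e'.
by rewrite (Prop_irrelevance e' e).
Defined.

Definition abcat_comp (C D E : abcat) (k : abcat_hom D E) (h : abcat_hom C D) :
  abcat_hom C E.
Proof.
exists (additive_comp (on_ob k) (on_ob h)) (additive_comp (on_mor k) (on_mor h)).
- by move=> m /=; rewrite on_mor_src on_mor_src.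
- by move=> m /=; rewrite on_mor_tgt on_mor_tgt.
- by move=> x /=; rewrite on_mor_ident on_mor_ident.
- move=> m n e e' /=.
  have eh : tgt (on_mor h m) = src (on_mor h n).
    by rewrite on_mor_src on_mor_tgt e.
  by rewrite (on_mor_icomp _ eh) (on_mor_icomp _ e').
Defined.

Lemma abcat_comp1 C D (h : abcat_hom C D) : abcat_comp h (abcat_id C) = h.
Proof. by apply: abcat_hom_ext; apply: additive_ext. Qed.

Lemma abcat_1comp C D (h : abcat_hom C D) : abcat_comp (abcat_id D) h = h.
Proof. by apply: abcat_hom_ext; apply: additive_ext. Qed.

Lemma abcat_compA A B C D (h : abcat_hom C D) (g : abcat_hom B C)
    (f : abcat_hom A B) :
  abcat_comp h (abcat_comp g f) = abcat_comp (abcat_comp h g) f.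
Proof. by apply: abcat_hom_ext; apply: additive_ext. Qed.

(* Mod(ABGRP, Cat): product-preserving functors from the Lawvere theory of
   abelian groups to Cat, in their equivalent form as categories internal to
   abelian groups. *)
Definition ABCAT : category := Category abcat_comp1 abcat_1comp abcat_compA.

Section FreeClosure.
Variable P : znet.
Local Notation LS := (L (place P) : zmodType).

Inductive mexpr : LS -> LS -> Type :=
| Gen (t : trans P) : mexpr (net_src t) (net_tgt t)
| Id (x : LS) : mexpr x x
| Comp x y z (a : mexpr x y) (b : mexpr y z) : mexpr x z
| Zero : mexpr 0 0
| Add x y x' y' (a : mexpr x y) (a' : mexpr x' y') : mexpr (x + x') (y + y')
| Opp x y (a : mexpr x y) : mexpr (- x) (- y).

(* The congruence generated by the axioms of a category, those of an abelian
   group, and the requirement that identity ([meq_IdD]) and composition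
   ([meq_CompD]) be homomorphisms; that source and target are homomorphisms is
   built into the indices of [mexpr].  The relation is heterogeneous because
   the two sides of, e.g., [meq_AddA] have indices that are only provably
   equal. *)
Inductive meq : forall x y x' y', mexpr x y -> mexpr x' y' -> Prop :=
| meq_refl x y (a : mexpr x y) : meq a a
| meq_sym x y x' y' (a : mexpr x y) (b : mexpr x' y') : meq a b -> meq b a
| meq_trans x y x' y' x'' y''
    (a : mexpr x y) (b : mexpr x' y') (c : mexpr x'' y'') :
    meq a b -> meq b c -> meq a c
| meq_Comp x y z x' y' z' (a : mexpr x y) (b : mexpr y z)
    (a' : mexpr x' y') (b' : mexpr y' z') :
    meq a a' -> meq b b' -> meq (Comp a b) (Comp a' b')
| meq_Add x y x' y' u v u' v' (a : mexpr x y) (b : mexpr x' y')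
    (a' : mexpr u v) (b' : mexpr u' v') :
    meq a a' -> meq b b' -> meq (Add a b) (Add a' b')
| meq_Opp x y x' y' (a : mexpr x y) (a' : mexpr x' y') :
    meq a a' -> meq (Opp a) (Opp a')
| meq_1Comp x y (a : mexpr x y) : meq (Comp (Id x) a) a
| meq_Comp1 x y (a : mexpr x y) : meq (Comp a (Id y)) a
| meq_CompA x y z w (a : mexpr x y) (b : mexpr y z) (c : mexpr z w) :
    meq (Comp a (Comp b c)) (Comp (Comp a b) c)
| meq_AddA x y x' y' x'' y''
    (a : mexpr x y) (b : mexpr x' y') (c : mexpr x'' y'') :
    meq (Add a (Add b c)) (Add (Add a b) c)
| meq_AddC x y x' y' (a : mexpr x y) (b : mexpr x' y') :
    meq (Add a b) (Add b a)
| meq_0Add x y (a : mexpr x y) : meq (Add Zero a) a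
| meq_NAdd x y (a : mexpr x y) : meq (Add (Opp a) a) Zero
| meq_IdD x y : meq (Id (x + y)) (Add (Id x) (Id y))
| meq_CompD x y z x' y' z' (a : mexpr x y) (b : mexpr y z)
    (a' : mexpr x' y') (b' : mexpr y' z') :
    meq (Comp (Add a a') (Add b b')) (Add (Comp a b) (Comp a' b')).

(* [q] exhibits the group of morphisms of [K], with all its structure, as the
   quotient of the expressions by [meq]. *)
Record is_free_closure (K : abcat_on LS)
    (q : forall x y, mexpr x y -> mor K) : Prop := IsFreeClosure {
  fc_src : forall x y (a : mexpr x y), src (q x y a) = x;
  fc_tgt : forall x y (a : mexpr x y), tgt (q x y a) = y;
  fc_Id : forall x, q x x (Id x) = ident x;
  fc_Comp : forall x y z (a : mexpr x y) (b : mexpr y z)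
      (e : tgt (q x y a) = src (q y z b)),
    q x z (Comp a b) = icomp (q x y a) (q y z b) e;
  fc_Zero : q 0 0 Zero = 0;
  fc_Add : forall x y x' y' (a : mexpr x y) (a' : mexpr x' y'),
    q (x + x') (y + y') (Add a a') = q x y a + q x' y' a';
  fc_Opp : forall x y (a : mexpr x y), q (- x) (- y) (Opp a) = - q x y a;
  fc_surj : forall m, exists x y (a : mexpr x y), q x y a = m;
  fc_eq : forall x y x' y' (a : mexpr x y) (b : mexpr x' y'),
    q x y a = q x' y' b <-> meq a b
}.
End FreeClosure.
Arguments mexpr P x y : clear implicits.
Arguments Gen {P} t.

(* [k] extends the action of [h] on transitions, lies over [L g] on objects
   (with [g] the action of [h] on places), and respects the group operation and
   composition. *)
Record extends_on_mor (P P' : znet) (h : znet_hom P P')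
    (K : abcat_on (L (place P))) (K' : abcat_on (L (place P')))
    (gen : trans P -> mor K) (gen' : trans P' -> mor K')
    (k : mor K -> mor K') : Prop := ExtendsOnMor {
  ext_gen : forall t, k (gen t) = gen' (on_trans h t);
  ext_src : forall m, src (k m) = fmap R (fmap L (on_place h)) (src m);
  ext_tgt : forall m, tgt (k m) = fmap R (fmap L (on_place h)) (tgt m);
  ext_add : forall m n, k (m + n) = k m + k n;
  ext_icomp : forall (m n : mor K) (e : tgt m = src n)
      (e' : tgt (k m) = src (k n)),
    k (icomp m n e) = icomp (k m) (k n) e'
}.

(* Main.v *)
Require Import Defs.
From HB Require Import structures.
From mathcomp Require Import all_boot all_algebra.
From mathcomp Require Import boolp.

(** Over a group of objects [O], an internal category in abelian groups is the
    same thing as a reflexive graph of abelian groups: since composition is a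
    homomorphism on composable pairs, the interchange of composition with
    addition (an Eckmann-Hilton argument) forces
      [icomp m n = m + n - ident (tgt m)]                          ([icompE]),
    and conversely this formula turns every reflexive graph into an internal
    category ([graph_abcat]), and every homomorphism of reflexive graphs into an
    internal functor ([graph_hom]).  Composition therefore never has to be
    treated on its own.

    The morphisms of the free internal category on [P] are the expressions
    [mexpr P] modulo [meq].  The group axioms among the generators of [meq] make
    this quotient [free_mor P] an abelian group; the indices of an expression
    give its source and target, [Id] gives the identities, and so the quotient is
    a reflexive graph, hence an internal category [free_abcat P].  The same
    interchange argument, now carried out inside [meq], identifies the class of
    [Comp a b] with the composite of the classes ([classComp]).  That the
    quotient is the free closure then holds by construction.

    The universal property has two halves.  Existence: a homomorphism on objects
    and a compatible assignment of morphisms to transitions define the value of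
    every expression by recursion; the value respects [meq] because the target
    satisfies the corresponding laws ([extension]).  Uniqueness: by [classComp]
    the group [free_mor P] is generated by the identities and the transitions
    ([free_mor_additive_ext]).  Functoriality, and the uniqueness of the
    extension of a morphism of nets, are instances of it.

    The right adjoint sends [C] to the net whose places are the objects of [C].
    A transition must have formal sums of objects as its ends, whereas a morphism
    of [C] has objects, so a transition is a morphism [m] together with formal
    sums [x] and [y] that evaluate in [ob C] to the source and the target of [m].
    A morphism of nets from [P] to it amounts to a map on places, extended
    additively, and a compatible choice of a morphism for every transition: this
    is exactly the data of the universal property. *)

Set Implicit Arguments.
Unset Strict Implicit.
Unset Printing Implicit Defensive.

Import GRing.Theory.
Local Open Scope ring_scope.
Local Open Scope quotient_scope.

(** * Homomorphisms of abelian groups *)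

Lemma freeZ_eq1 (S : Type) (A : zmodType) (f g : {additive freeZ S -> A}) :
  (forall x, f (freeZ_unit x) = g (freeZ_unit x)) -> f =1 g.
Proof. by move/freeZ_ext->. Qed.

Section AdditiveOf.
Variables (A B : zmodType) (f : A -> B) (fD : {morph f : x y / x + y}).

Lemma morphD_zmod_morphism : zmod_morphism f.
Proof. by move=> x y; apply: (addIr (f y)); rewrite subrK -fD subrK. Qed.

Definition additive_of : {additive A -> B} :=
  HB.pack_for {additive A -> B} f
    (GRing.isZmodMorphism.Build A B f morphD_zmod_morphism).

Lemma additive_ofE x : additive_of x = f x. Proof. by []. Qed.
End AdditiveOf.

(** * Internal categories as reflexive graphs *)

Section Composition.
Variables (O : zmodType) (C : abcat_on O).

Lemma icomp_eq (m n m' n' : mor C) (e : tgt m = src n) (e' : tgt m' = src n') :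
  m = m' -> n = n' -> icomp m n e = icomp m' n' e'.
Proof.
move=> em en; case: _ / em e' => e'; case: _ / en e' => e'.
by rewrite (Prop_irrelevance e e').
Qed.

(** Interchange: with [i] the identity at the middle object,
    [icomp m n + i = icomp m n + icomp i i = icomp (m + i) (n + i)
     = icomp (m + i) (i + n) = icomp m i + icomp i n = m + n]. *)
Lemma icompE (m n : mor C) (e : tgt m = src n) :
  icomp m n e = m + n - ident (tgt m).
Proof.
set i : mor C := ident (tgt m).
have mi : tgt m = src i by rewrite src_ident.
have i_n : tgt i = src n by rewrite tgt_ident.
have ii : tgt i = src i by rewrite src_ident tgt_ident.
have E1 : tgt (m + i) = src (i + n) by rewrite !raddfD src_ident tgt_ident e.
have E2 : tgt (m + i) = src (n + i) by rewrite (addrC n).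
apply/eqP; rewrite -subr_eq opprK; apply/eqP.
rewrite -[X in _ + X = _](icomp1l ii) -(icompD e ii E2).
rewrite (icomp_eq E2 E1 erefl (addrC n i)) (icompD mi i_n).
by rewrite (icomp1r mi) (icomp1l i_n).
Qed.
End Composition.

Section GraphCategory.
Variables (O M : zmodType) (s t : {additive M -> O}) (i : {additive O -> M}).
Hypotheses (si : forall x, s (i x) = x) (ti : forall x, t (i x) = x).

Definition graph_abcat : abcat_on O.
Proof.
pose c (m n : M) (_ : t m = s n) : M := m + n - i (t m).
apply: (@ABCatOn O M s t i c) => //; rewrite /c.
- by move=> m n e; rewrite raddfB raddfD si e addrK.
- by move=> m n e; rewrite raddfB raddfD ti addrAC subrr add0r.
- by move=> x m e; rewrite ti addrAC subrr add0r.
- by move=> m x e; rewrite e si addrK.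
- move=> m n p mn np mn_p m_np.
  have -> : t (m + n - i (t m)) = t n.
    by rewrite raddfB raddfD ti [t m + _]addrC addrK.
  by rewrite !addrA (addrAC _ (- i (t m)) p) [RHS]addrAC.
- move=> m n m' n' e e' ee'.
  by rewrite (raddfD t) (raddfD i) opprD (addrACA m) [LHS]addrACA.
Defined.
End GraphCategory.

Section GraphMorphism.
Variables (C D : abcat) (g : {additive ob C -> ob D})
  (k : {additive mor C -> mor D}).
Hypotheses (ks : forall m, src (k m) = g (src m))
           (kt : forall m, tgt (k m) = g (tgt m))
           (ki : forall x, k (ident x) = ident (g x)).

Lemma graph_hom_icomp (m n : mor C) (e : tgt m = src n)
    (e' : tgt (k m) = src (k n)) :
  k (icomp m n e) = icomp (k m) (k n) e'.
Proof. by rewrite !icompE raddfB raddfD ki kt. Qed.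

Definition graph_hom : abcat_hom C D := ABCatHom ks kt ki graph_hom_icomp.
End GraphMorphism.

(** * The free internal category of a net *)

Section FreeAbcat.
Variable P : znet.
Local Notation LS := (L (place P) : zmodType).

(** All expressions in one type, so that the heterogeneous relation [meq]
    becomes an equivalence relation with a quotient. *)
Record expr := Expr { esrc : LS; etgt : LS; eterm : mexpr P esrc etgt }.

Definition expr_equiv : rel {classic expr} :=
  fun a b => `[< meq (eterm (a : expr)) (eterm (b : expr)) >].

Lemma expr_equivP : equiv_class_of expr_equiv.
Proof.
split.
- by move=> a; apply/asboolP; apply: meq_refl.
- by move=> a b; apply/asboolP/asboolP; apply: meq_sym.
- move=> b a c /asboolP ab /asboolP bc.
  by apply/asboolP; apply: meq_trans ab bc.
Qed.

Canonical expr_equivRel := EquivRelPack expr_equivP.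

Definition free_mor : Type := {eq_quot expr_equiv}.
HB.instance Definition _ := Choice.on free_mor.

Definition class x y (a : mexpr P x y) : free_mor :=
  \pi_({eq_quot expr_equiv}) (Expr a : {classic expr}).

Lemma class_eq x y x' y' (a : mexpr P x y) (b : mexpr P x' y') :
  class a = class b <-> meq a b.
Proof.
split=> [/eqquotP/asboolP //|ab].
by apply/eqquotP/asboolP.
Qed.

Definition rep (m : free_mor) : expr := repr (m : {eq_quot expr_equiv}).

Lemma repK m : class (eterm (rep m)) = m.
Proof.
rewrite -[RHS](reprK (m : {eq_quot expr_equiv})) /class -/(rep m).
by case: (rep m).
Qed.

Lemma meq_rep x y (a : mexpr P x y) : meq (eterm (rep (class a))) a.
Proof. by apply/class_eq; apply: repK. Qed.

Definition free_add (m n : free_mor) :=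
  class (Add (eterm (rep m)) (eterm (rep n))).
Definition free_opp (m : free_mor) := class (Opp (eterm (rep m))).

Lemma free_add_class x y x' y' (a : mexpr P x y) (b : mexpr P x' y') :
  free_add (class a) (class b) = class (Add a b).
Proof. by apply/class_eq; apply: meq_Add; apply: meq_rep. Qed.

Lemma free_opp_class x y (a : mexpr P x y) : free_opp (class a) = class (Opp a).
Proof. by apply/class_eq; apply: meq_Opp; apply: meq_rep. Qed.

Lemma free_addA : associative free_add.
Proof.
move=> m n p; rewrite -(repK m) -(repK n) -(repK p) !free_add_class.
by apply/class_eq; apply: meq_AddA.
Qed.

Lemma free_addC : commutative free_add.
Proof. by move=> m n; apply/class_eq; apply: meq_AddC. Qed.

Lemma free_add0 : left_id (class (Zero P)) free_add.
Proof.
move=> m; rewrite -(repK m) free_add_class.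
by apply/class_eq; apply: meq_0Add.
Qed.

Lemma free_addN : left_inverse (class (Zero P)) free_opp free_add.
Proof.
move=> m; rewrite -(repK m) free_opp_class free_add_class.
by apply/class_eq; apply: meq_NAdd.
Qed.

HB.instance Definition _ :=
  GRing.isZmodule.Build free_mor free_addA free_addC free_add0 free_addN.

Lemma class0 : class (Zero P) = 0. Proof. by []. Qed.

Lemma classD x y x' y' (a : mexpr P x y) (b : mexpr P x' y') :
  class (Add a b) = class a + class b.
Proof. by rewrite -free_add_class. Qed.

Lemma classN x y (a : mexpr P x y) : class (Opp a) = - class a.
Proof. by rewrite -free_opp_class. Qed.

(** The interchange argument of [icompE], on expressions.  The commutation
    [Add b (Id y)] ~ [Add (Id y) b] leaves the source [y + y] unchanged, which
    is what allows it under [Comp]. *)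
Lemma classComp x y z (a : mexpr P x y) (b : mexpr P y z) :
  class (Comp a b) = class a + class b - class (Id y).
Proof.
have idid : class (Comp (Id y) (Id y)) = class (Id y).
  by apply/class_eq; apply: meq_1Comp.
apply/eqP; rewrite -subr_eq opprK -[X in _ + X]idid -classD -classD.
apply/eqP/class_eq.
apply: meq_trans (meq_sym (meq_CompD _ _ _ _)) _.
apply: meq_trans (meq_Comp (meq_refl _) (meq_AddC _ _)) _.
apply: meq_trans (meq_CompD _ _ _ _) _.
by apply: meq_Add; [apply: meq_Comp1 | apply: meq_1Comp].
Qed.

Lemma class_surj m : exists x y (a : mexpr P x y), class a = m.
Proof. by exists _, _, (eterm (rep m)); rewrite repK. Qed.

(** The two ends of each relation are formed by the same group operations on
    free abelian groups, so the laws of these groups equate them. *)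
Lemma meq_ends x y x' y' (a : mexpr P x y) (b : mexpr P x' y') :
  meq a b -> x = x' /\ y = y'.
Proof.
elim=> {x y x' y' a b}.
- by [].
- by move=> x y x' y' a b _ [-> ->].
- by move=> x y x' y' x'' y'' a b c _ [-> ->] _ [-> ->].
- by move=> x y z x' y' z' a b a' b' _ [-> _] _ [_ ->].
- by move=> x y x' y' u v u' v' a b a' b' _ [-> ->] _ [-> ->].
- by move=> x y x' y' a a' _ [-> ->].
- by [].
- by [].
- by [].
- by move=> x y x' y' x'' y'' a b c; rewrite !addrA.
- by move=> x y x' y' a b; split; apply: addrC.
- by move=> x y a; rewrite !add0r.
- by move=> x y a; rewrite !addNr.
- by [].
- by [].
Qed.

(** Homomorphisms out of the quotient are invariant functions on expressions
    that turn [Add] into addition. *)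
Section Induced.
Variables (A : zmodType) (v : forall x y, mexpr P x y -> A).
Hypotheses (v_meq : forall x y x' y' (a : mexpr P x y) (b : mexpr P x' y'),
                meq a b -> v a = v b)
           (vD : forall x y x' y' (a : mexpr P x y) (b : mexpr P x' y'),
                v (Add a b) = v a + v b).

Definition induced_fun (m : free_mor) : A := v (eterm (rep m)).

Lemma induced_class x y (a : mexpr P x y) : induced_fun (class a) = v a.
Proof. exact: v_meq (meq_rep a). Qed.

Lemma induced_funD : {morph induced_fun : m n / m + n}.
Proof. by move=> m n; rewrite [LHS](induced_class (Add _ _)) vD. Qed.

Definition induced : {additive free_mor -> A} := additive_of induced_funD.
End Induced.

Definition free_src : {additive free_mor -> LS} :=
  @induced LS (fun x _ _ => x) (fun _ _ _ _ _ _ ab => proj1 (meq_ends ab))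
    (fun _ _ _ _ _ _ => erefl).

Definition free_tgt : {additive free_mor -> LS} :=
  @induced LS (fun _ y _ => y) (fun _ _ _ _ _ _ ab => proj2 (meq_ends ab))
    (fun _ _ _ _ _ _ => erefl).

Lemma free_src_class x y (a : mexpr P x y) : free_src (class a) = x.
Proof. by case: (meq_ends (meq_rep a)). Qed.

Lemma free_tgt_class x y (a : mexpr P x y) : free_tgt (class a) = y.
Proof. by case: (meq_ends (meq_rep a)). Qed.

Lemma classIdD : {morph (fun x : LS => class (Id x)) : x y / x + y}.
Proof. by move=> x y; rewrite -classD; apply/class_eq; apply: meq_IdD. Qed.

Definition free_ident : {additive LS -> free_mor} := additive_of classIdD.

Definition free_abcat : abcat_on LS :=
  @graph_abcat LS free_mor free_src free_tgt free_ident
    (fun x => free_src_class (Id x)) (fun x => free_tgt_class (Id x)).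

Definition gen_mor (t : trans P) : mor free_abcat := class (Gen t).

Lemma free_abcat_is_free_closure : @is_free_closure P free_abcat class.
Proof.
split.
- exact: free_src_class.
- exact: free_tgt_class.
- by [].
- move=> x y z a b e; rewrite icompE classComp.
  by congr (_ - class (Id _)); rewrite free_tgt_class.
- exact: class0.
- exact: classD.
- exact: classN.
- exact: class_surj.
- exact: class_eq.
Qed.

(** The identities and the transitions generate the group of morphisms, since
    by [classComp] composition adds nothing to the group operations. *)
Lemma free_mor_additive_ext (A : zmodType)
    (k k' : {additive mor free_abcat -> A}) :
  (forall x, k (ident x) = k' (ident x)) ->
  (forall t, k (gen_mor t) = k' (gen_mor t)) -> k =1 k'.
Proof.
move=> kid kgen m; have [x [y [a <-]]] := class_surj m.
elim: a => {x y} [t|x|x y z a IHa b IHb||x y x' y' a IHa b IHb|x y a IHa].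
- exact: kgen.
- exact: kid.
- by rewrite classComp !raddfB !raddfD IHa IHb; congr (_ - _); apply: kid.
- by rewrite class0 !raddf0.
- by rewrite classD !raddfD IHa IHb.
- by rewrite classN !raddfN IHa.
Qed.

Section Extension.
Variables (C : abcat) (g : {additive LS -> ob C}) (f : trans P -> mor C).
Hypotheses (fs : forall t, src (f t) = g (net_src t))
           (ft : forall t, tgt (f t) = g (net_tgt t)).

(** [Comp] is read through the formula of [icompE]: a genuine composite in [C]
    would need a proof that its factors are composable at every node. *)
Fixpoint eval x y (a : mexpr P x y) : mor C :=
  match a with
  | Gen t => f t
  | Id x => ident (g x)
  | Comp x y z a b => eval a + eval b - ident (g y)
  | Zero => 0
  | Add x y x' y' a b => eval a + eval b
  | Opp x y a => - eval a
  end.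

(** With [Comp] read as a sum, every case is an identity in the abelian group of
    morphisms of [C]; only the congruence rule for [Comp] also uses that
    equivalent expressions have the same target. *)
Lemma eval_meq x y x' y' (a : mexpr P x y) (b : mexpr P x' y') :
  meq a b -> eval a = eval b.
Proof.
elim=> {x y x' y' a b} /=.
- by [].
- by [].
- by move=> x y x' y' x'' y'' a b c _ -> _ ->.
- move=> x y z x' y' z' a b a' b' /meq_ends[_ yy'] -> _ ->.
  by congr (_ - ident (g _)).
- by move=> x y x' y' u v u' v' a b a' b' _ -> _ ->.
- by move=> x y x' y' a a' _ ->.
- by move=> x y a; rewrite addrC addKr.
- by move=> x y a; rewrite addrK.
- move=> x y z w a b c.
  by rewrite !addrA (addrAC _ (- ident (g y)) (eval c)) [RHS]addrAC.
- by move=> *; rewrite addrA.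
- by move=> *; rewrite addrC.
- by move=> *; rewrite add0r.
- by move=> *; rewrite addNr.
- by move=> x y; rewrite !raddfD.
- move=> x y z x' y' z' a b a' b'.
  by rewrite (raddfD g) (raddfD ident) opprD (addrACA (eval a)) [LHS]addrACA.
Qed.

Definition extension_mor : {additive mor free_abcat -> mor C} :=
  induced eval_meq (fun _ _ _ _ _ _ => erefl).

Lemma extension_mor_class x y (a : mexpr P x y) :
  extension_mor (class a) = eval a.
Proof. exact: induced_class eval_meq _ _ _. Qed.

Lemma extension_ident x : extension_mor (ident x) = ident (g x).
Proof. exact: extension_mor_class. Qed.

Lemma extension_src m : src (extension_mor m) = g (src m).
Proof.
apply: (@free_mor_additive_ext _ (src \o extension_mor) (g \o src)) m => [x|t].
  change (src (extension_mor (ident x)) = g (src (ident x : mor free_abcat))).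
  by rewrite extension_ident !src_ident.
change (src (extension_mor (gen_mor t)) = g (src (gen_mor t))).
by rewrite extension_mor_class [src (gen_mor t)]free_src_class fs.
Qed.

Lemma extension_tgt m : tgt (extension_mor m) = g (tgt m).
Proof.
apply: (@free_mor_additive_ext _ (tgt \o extension_mor) (g \o tgt)) m => [x|t].
  change (tgt (extension_mor (ident x)) = g (tgt (ident x : mor free_abcat))).
  by rewrite extension_ident !tgt_ident.
change (tgt (extension_mor (gen_mor t)) = g (tgt (gen_mor t))).
by rewrite extension_mor_class [tgt (gen_mor t)]free_tgt_class ft.
Qed.

Definition extension : abcat_hom (ABCat free_abcat) C :=
  @graph_hom (ABCat free_abcat) C g extension_mor
    extension_src extension_tgt extension_ident.

Lemma extension_gen t : on_mor extension (gen_mor t) = f t.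
Proof. exact: extension_mor_class. Qed.
End Extension.

(** Uniqueness in the universal property: an internal functor is determined by
    its values on places and transitions. *)
Lemma free_abcat_hom_ext (C : abcat) (h k : abcat_hom (ABCat free_abcat) C) :
  (forall x : place P, on_ob h (freeZ_unit x) = on_ob k (freeZ_unit x)) ->
  (forall t, on_mor h (gen_mor t) = on_mor k (gen_mor t)) -> h = k.
Proof.
move=> /freeZ_ext eo em; apply: abcat_hom_ext => //.
apply: additive_ext; apply: free_mor_additive_ext => // x.
by rewrite !on_mor_ident eo.
Qed.
End FreeAbcat.

(** * Functoriality *)

Section FreeMap.
Variables (P P' : znet) (h : znet_hom P P').

Lemma free_map_src t :
  src (gen_mor (on_trans h t)) = freeZ_map (on_place h) (net_src t).
Proof. by rewrite [src _]free_src_class on_src. Qed.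

Lemma free_map_tgt t :
  tgt (gen_mor (on_trans h t)) = freeZ_map (on_place h) (net_tgt t).
Proof. by rewrite [tgt _]free_tgt_class on_tgt. Qed.

Definition free_map :
    abcat_hom (ABCat (free_abcat P)) (ABCat (free_abcat P')) :=
  @extension P (ABCat (free_abcat P')) (freeZ_map (on_place h))
    (fun t => gen_mor (on_trans h t)) free_map_src free_map_tgt.

Lemma free_map_gen t : on_mor free_map (gen_mor t) = gen_mor (on_trans h t).
Proof. exact: extension_gen. Qed.

Lemma free_map_unit x :
  on_ob free_map (freeZ_unit x) = freeZ_unit (on_place h x).
Proof. exact: freeZ_liftU. Qed.

Lemma free_map_extends :
  extends_on_mor h (@gen_mor P) (@gen_mor P') (on_mor free_map).
Proof.
split.
- exact: free_map_gen.
- exact: (on_mor_src free_map).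
- exact: (on_mor_tgt free_map).
- exact: raddfD.
- move=> m n e e'; exact: (@on_mor_icomp _ _ free_map m n e e').
Qed.

(** A map that respects addition and composition also preserves identities, as
    these are the idempotents for composition; it is then determined by
    [free_mor_additive_ext]. *)
Lemma free_map_unique (k : mor (free_abcat P) -> mor (free_abcat P')) :
  extends_on_mor h (@gen_mor P) (@gen_mor P') k -> k =1 on_mor free_map.
Proof.
case=> kgen ksrc ktgt kD kcomp.
apply: (@free_mor_additive_ext P _ (additive_of kD)) => [x|t].
  rewrite [RHS](on_mor_ident free_map) additive_ofE; set i := ident x.
  have ii : tgt i = src i by rewrite src_ident tgt_ident.
  have kii : tgt (k i) = src (k i) by rewrite ksrc ktgt ii.
  (* [k i] composed with itself is [k i]; by [icompE] this reads
     [k i = k i + k i - ident (tgt (k i))]. *)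
  have := kcomp _ _ ii kii; rewrite icomp1l icompE ktgt tgt_ident.
  move/(congr1 (fun m => m - k i)).
  by rewrite subrr addrAC addrK => /esym/subr0_eq.
by rewrite free_map_gen; apply: kgen.
Qed.
End FreeMap.

Lemma free_map_functor :
  @is_functor ZNET ABCAT (fun P : znet => ABCat (free_abcat P)) free_map.
Proof.
split=> [P|P P' P'' h' h]; apply: free_abcat_hom_ext => z.
- exact: free_map_unit.
- exact: free_map_gen.
- change (on_ob (free_map (znet_comp h' h)) (freeZ_unit z) =
    on_ob (free_map h') (on_ob (free_map h) (freeZ_unit z))).
  by rewrite !free_map_unit.
- change (on_mor (free_map (znet_comp h' h)) (gen_mor z) =
    on_mor (free_map h') (on_mor (free_map h) (gen_mor z))).
  by rewrite !free_map_gen.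
Qed.

(** * The underlying net of an internal category *)

Definition counit (A : zmodType) : {additive freeZ A -> A} :=
  freeZ_lift (fun x : A => x).

Lemma counit_nat (A B : zmodType) (f : {additive A -> B}) D :
  counit B (freeZ_map f D) = f (counit A D).
Proof.
apply: (@freeZ_eq1 _ _ (additive_comp (counit B) (freeZ_map f))
  (additive_comp f (counit A))) => x.
by rewrite /= !freeZ_liftU.
Qed.

Lemma counit_map (S : Type) (A : zmodType) (g : S -> A) D :
  counit A (freeZ_map g D) = freeZ_lift g D.
Proof.
apply: (@freeZ_eq1 _ _ (additive_comp (counit A) (freeZ_map g))) => x.
by rewrite /= !freeZ_liftU.
Qed.

(** A morphism of [C] with a presentation of its ends by formal sums of objects.
    The sums are data: a morphism of nets has to match the formal ends of a
    transition, not only their values. *)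
Record net_trans (C : abcat) := NetTrans {
  trans_mor : mor C;
  trans_src : freeZ (ob C);
  trans_tgt : freeZ (ob C);
  trans_srcP : src trans_mor = counit (ob C) trans_src;
  trans_tgtP : tgt trans_mor = counit (ob C) trans_tgt
}.

Lemma net_trans_ext (C : abcat) (a b : net_trans C) :
  trans_mor a = trans_mor b -> trans_src a = trans_src b ->
  trans_tgt a = trans_tgt b -> a = b.
Proof.
case: a b => [m x y p q] [m' x' y' p' q'] /= em ex ey.
case: _ / em p' q'; case: _ / ex => p'; case: _ / ey => q'.
by rewrite (Prop_irrelevance p p') (Prop_irrelevance q q').
Qed.

Definition underlying_net (C : abcat) : znet :=
  @ZNet (net_trans C) (ob C) (@trans_src C) (@trans_tgt C).

Section UnderlyingMap.
Variables (C D : abcat) (h : abcat_hom C D).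

Lemma underlying_map_src (a : net_trans C) :
  src (on_mor h (trans_mor a)) =
  counit (ob D) (freeZ_map (on_ob h) (trans_src a)).
Proof. by rewrite on_mor_src trans_srcP counit_nat. Qed.

Lemma underlying_map_tgt (a : net_trans C) :
  tgt (on_mor h (trans_mor a)) =
  counit (ob D) (freeZ_map (on_ob h) (trans_tgt a)).
Proof. by rewrite on_mor_tgt trans_tgtP counit_nat. Qed.

Definition underlying_map : znet_hom (underlying_net C) (underlying_net D) :=
  @ZNetHom (underlying_net C) (underlying_net D)
    (fun a => NetTrans (underlying_map_src a) (underlying_map_tgt a))
    (on_ob h) (fun _ => erefl) (fun _ => erefl).
End UnderlyingMap.

Lemma underlying_map_functor :
  @is_functor ABCAT ZNET underlying_net underlying_map.
Proof.
split=> [C|C D E k h]; apply: znet_hom_ext => //; apply/funext => a.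
  have mapid (d : freeZ (ob C)) : freeZ_map (fun x => x) d = d.
    by rewrite freeZ_map_id.
  by apply: net_trans_ext; [| apply: mapid..].
have mapcomp (d : freeZ (ob C)) :
    freeZ_map (fun x => on_ob k (on_ob h x)) d =
    freeZ_map (on_ob k) (freeZ_map (on_ob h) d).
  by rewrite (freeZ_map_comp (on_ob k) (on_ob h)).
by apply: net_trans_ext; [| apply: mapcomp..].
Qed.

Definition underlying : functor ABCAT ZNET := Functor underlying_map_functor.

(** * The adjunction *)

Section Transpose.
Variables (P : znet) (C : abcat).

Section ToNet.
Variable u : abcat_hom (ABCat (free_abcat P)) C.

Let on_places : place P -> ob C := fun x => on_ob u (freeZ_unit x).

Lemma on_ob_lift D : on_ob u D = counit (ob C) (freeZ_map on_places D).
Proof.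
rewrite counit_map; apply: (@freeZ_eq1 _ _ (on_ob u)) => x.
by rewrite freeZ_liftU.
Qed.

Lemma transpose_src t :
  src (on_mor u (gen_mor t)) = counit (ob C) (freeZ_map on_places (net_src t)).
Proof. by rewrite on_mor_src [src _]free_src_class; apply: on_ob_lift. Qed.

Lemma transpose_tgt t :
  tgt (on_mor u (gen_mor t)) = counit (ob C) (freeZ_map on_places (net_tgt t)).
Proof. by rewrite on_mor_tgt [tgt _]free_tgt_class; apply: on_ob_lift. Qed.

Definition transpose : znet_hom P (underlying_net C) :=
  @ZNetHom P (underlying_net C)
    (fun t => NetTrans (transpose_src t) (transpose_tgt t))
    on_places (fun _ => erefl) (fun _ => erefl).
End ToNet.

Section FromNet.
Variable v : znet_hom P (underlying_net C).

Lemma untranspose_src t :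
  src (trans_mor (on_trans v t)) = freeZ_lift (on_place v) (net_src t).
Proof.
by rewrite trans_srcP -counit_map; congr (counit _ _); apply: (on_src v).
Qed.

Lemma untranspose_tgt t :
  tgt (trans_mor (on_trans v t)) = freeZ_lift (on_place v) (net_tgt t).
Proof.
by rewrite trans_tgtP -counit_map; congr (counit _ _); apply: (on_tgt v).
Qed.

Definition untranspose : abcat_hom (ABCat (free_abcat P)) C :=
  extension untranspose_src untranspose_tgt.
End FromNet.

Lemma transpose_bij : bijective transpose.
Proof.
exists untranspose => [u|v].
  apply: free_abcat_hom_ext => [x|t]; first exact: freeZ_liftU.
  exact: extension_gen.
(* The ends of a transition in the image of a morphism of nets are determined by
   the action on places, so only [on_place] and [trans_mor] are compared. *)
have places : on_place (transpose (untranspose v)) = on_place v.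
  by apply/funext => x; apply: freeZ_liftU.
apply: znet_hom_ext => //; apply/funext => t; apply: net_trans_ext.
- exact: extension_gen.
- by rewrite [LHS](on_src (transpose _)) [RHS](on_src v) places.
- by rewrite [LHS](on_tgt (transpose _)) [RHS](on_tgt v) places.
Qed.
End Transpose.

Lemma transpose_nat (P P' : znet) (C C' : abcat) (f : znet_hom P' P)
    (u : abcat_hom (ABCat (free_abcat P)) C) (h : abcat_hom C C') :
  transpose (abcat_comp h (abcat_comp u (free_map f))) =
  znet_comp (underlying_map h) (znet_comp (transpose u) f).
Proof.
set l := transpose _; set r := znet_comp _ _.
have places : on_place l = on_place r.
  apply/funext => x.
  by rewrite /l /= -[freeZ_lift _ _]/(on_ob (free_map f) _) free_map_unit.
apply: znet_hom_ext => //; apply/funext => t; apply: net_trans_ext.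
- exact: (congr1 (fun m => on_mor h (on_mor u m)) (free_map_gen f t)).
- by rewrite [LHS](on_src l) [RHS](on_src r) places.
- by rewrite [LHS](on_tgt l) [RHS](on_tgt r) places.
Qed.

Theorem proposition6p5 :
  exists (K : forall P : znet, abcat_on (L (place P)))
         (F1 : forall P P' : znet, znet_hom P P' ->
            abcat_hom (ABCat (K P)) (ABCat (K P')))
         (FP : @is_functor ZNET ABCAT (fun P : znet => ABCat (K P)) F1)
         (q : forall (P : znet) (x y : L (place P)),
            mexpr P x y -> mor (K P)),
    is_left_adjoint (Functor FP) /\
    (forall P : znet, is_free_closure (q P)) /\
    (forall (P P' : znet) (h : znet_hom P P'),
      let gen (Q : znet) (t : trans Q) : mor (K Q) := q Q _ _ (Gen t) in
      on_ob (F1 P P' h) = fmap L (on_place h) /\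
      extends_on_mor h (gen P) (gen P') (on_mor (F1 P P' h)) /\
      (forall k : mor (K P) -> mor (K P'),
        extends_on_mor h (gen P) (gen P') k ->
        forall m, k m = on_mor (F1 P P' h) m)).
Proof.
exists free_abcat, free_map, free_map_functor, class.
split; [|split].
- exists underlying; constructor.
  exact: (@Adjunction ZNET ABCAT (Functor free_map_functor) underlying
    transpose transpose_bij transpose_nat).
- exact: free_abcat_is_free_closure.
- move=> P P' h gen; split; [by []|split].
    exact: free_map_extends.
  exact: free_map_unique.
Qed.
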